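(* Let $p$ be a non-principal ultrafilter on $\mathbb{N}$, regarded as a point of the Stone–Čech compactification $\beta\mathbb{N}$, and let $\pi_1 \colon \mathbb{N} \times \mathbb{N} \to \mathbb{N}$ be the projection to the first factor. Then the induced map $\beta\pi_1 \colon \beta(\mathbb{N} \times \mathbb{N}) \to \beta\mathbb{N}$ does not admit a fiber over $p$ in $\mathrm{ExtrDisc}$; i.e. the pullback of $\beta\pi_1$ along $p \colon * \to \beta\mathbb{N}$ does not exist in $\mathrm{ExtrDisc}$.
   Context: An extremally disconnected space is a compact Hausdorff space in which the closure of every open set is open. $\mathrm{ExtrDisc}$ is the category of extremally disconnected spaces and continuous maps. For a set $S$, $\beta S$ is the set of ultrafilters on $S$ with the topology generated by the sets $A^* := \{u \in \beta S : A \in u\}$ for $A \subseteq S$; it is an extremally disconnected space. A map of sets $f \colon S \to T$ induces the continuous map $\beta f \colon \beta S \to \beta T$, $u \mapsto \{B \subseteq T : f^{-1}(B) \in u\}$. An ultrafilter on $S$ is principal if it is of the form $\{A \subseteq S : s \in A\}$ for some $s \in S$, and non-principal otherwise. *)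

(* Defs.v *)
From HB Require Import structures.
From mathcomp Require Import all_boot finmap.
From mathcomp Require Import all_classical.
From mathcomp Require Import topology.
Set Implicit Arguments.
Unset Strict Implicit.
Unset Printing Implicit Defensive.

Local Open Scope classical_set_scope.

(* The empty space is allowed: topologicalType does not require a point. *)
HB.mixin Record isExtrDisc T & Topological T := {
  extrdisc_compact : compact [set: T];
  extrdisc_hausdorff : hausdorff_space T;
  extrdisc_closure_open : forall U : set T, open U -> open (closure U)
}.

#[short(type="extrDiscType")]
HB.structure Definition ExtrDisc := {T of Topological T & isExtrDisc T}.

(* The square  P --q2--> Y
               |         |
               q1        g
               v         v
               X --f-->  Z   is cartesian in ExtrDisc. *)
Definition is_pullback (X Y Z P : extrDiscType)
    (f : continuousType X Z) (g : continuousType Y Z)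
    (q1 : continuousType P X) (q2 : continuousType P Y) : Prop :=
  f \o q1 =1 g \o q2 /\
  forall (T : extrDiscType) (t1 : continuousType T X) (t2 : continuousType T Y),
    f \o t1 =1 g \o t2 ->
    exists! h : continuousType T P, q1 \o h =1 t1 /\ q2 \o h =1 t2.

Definition has_pullback (X Y Z : extrDiscType)
    (f : continuousType X Z) (g : continuousType Y Z) : Prop :=
  exists (P : extrDiscType) (q1 : continuousType P X) (q2 : continuousType P Y),
    is_pullback f g q1 q2.

Definition point_space : Type := discrete_topology unit.
HB.instance Definition _ := DiscreteTopology.on point_space.

Lemma point_space_compact : compact [set: point_space].
Proof.
move=> F FF _; exists tt; split=> // A B FA; rewrite nbhs_principalE.
by move/principal_filterP => Btt; have /filter_ex [[] Att] := FA; exists tt.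
Qed.

Lemma point_space_hausdorff : hausdorff_space point_space.
Proof. by case; case. Qed.

Lemma point_space_closure_open (U : set point_space) :
  open U -> open (closure U).
Proof. by move=> _; exact: discrete_open. Qed.

HB.instance Definition _ :=
  isExtrDisc.Build point_space point_space_compact point_space_hausdorff
    point_space_closure_open.

Record stone_cech (S : Type) := StoneCech {
  ultra_of : set_system S;
  ultra_ofP : UltraFilter ultra_of
}.
#[global] Existing Instance ultra_ofP.

HB.instance Definition _ (S : Type) := gen_eqMixin (stone_cech S).
HB.instance Definition _ (S : Type) := gen_choiceMixin (stone_cech S).

Definition principal (S : Type) (u : stone_cech S) : Prop :=
  exists s : S, ultra_of u = principal_filter s.

Definition basic_open (S : Type) (A : set S) : set (stone_cech S) :=
  [set u : stone_cech S | ultra_of u A].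

HB.instance Definition _ (S : Type) :=
  isSubBaseTopological.Build (stone_cech S) [set: set S] (@basic_open S).

Lemma proper_notC (S : Type) (F : set_system S) (A : set S) :
  ProperFilter F -> F A -> F (~` A) -> False.
Proof. by move=> FF FA /(filterI FA); rewrite setICr => /filter_not_empty. Qed.

Section stone_cech_extrdisc.
Variable S : Type.
Implicit Types (u v : stone_cech S) (A B : set S) (U : set (stone_cech S)).

Lemma stone_cechP u v : ultra_of u `<=` ultra_of v -> u = v.
Proof.
case: u v => [u uU] [v vU] /= /max_filter uv.
move: vU; rewrite uv => vU; congr StoneCech; exact: Prop_irrelevance.
Qed.

Lemma ultraC u A : ~ ultra_of u A -> ultra_of u (~` A).
Proof. by have [] := in_ultra_setVsetC A (ultra_ofP u). Qed.

Definition principal_ultra (s : S) : stone_cech S :=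
  StoneCech (principal_filter_ultra s).

Lemma open_basic A : open (basic_open A).
Proof.
exists [set basic_open A]; last by rewrite bigcup_set1.
by move=> _ ->; exact: finI_from1.
Qed.

Lemma nbhs_stone_cech u U :
  nbhs u U <-> exists2 A, ultra_of u A & basic_open A `<=` U.
Proof.
split=> [|[A uA AU]]; last first.
  by apply: (filterS AU); apply: open_nbhs_nbhs; split=> //; exact: open_basic.
rewrite nbhsE /= => -[V [[D Dfin DV] Vu] VU].
have [W DW Wu] : (\bigcup_(i in D) i) u by rewrite DV.
have [E _ EW] := Dfin _ DW.
exists (\bigcap_(A in [set` E]) A).
  apply: filter_bigI => A EA; move: Wu; rewrite -EW => WE; exact: (WE A EA).
move=> v vE; apply: VU; rewrite -DV; exists W => //.
suff : W v by []; rewrite -EW => A EA.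
by apply: filterS vE => s /(_ _ EA).
Qed.

Lemma stone_cech_compact : compact [set: stone_cech S].
Proof.
rewrite compact_ultra => F FU _.
pose u : set_system S := [set A | F (basic_open A)].
have uE A : u A = F (basic_open A) by [].
have uP : ProperFilter u.
  apply: Build_ProperFilter_ex; first move=> A.
    by rewrite uE => /filter_ex[v vA]; exact: filter_ex vA.
  split=> [|A B|A B AB]; rewrite !uE.
  - by apply: filterS filterT => v _; exact: filterT.
  - by apply: filterS2 => v; exact: filterI.
  - by apply: filterS => v; exact: filterS.
have uU : UltraFilter u.
  split=> // G GP uG; rewrite eqEsubset; split=> // A GA.
  have [//|nA] := in_ultra_setVsetC (basic_open A) FU.
  have /uG GnA : u (~` A) by apply: filterS nA => v; exact: ultraC.
  by have := proper_notC _ GA GnA.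
exists (StoneCech uU); split=> // U /nbhs_stone_cech [A uA AU].
exact: filterS AU uA.
Qed.

Lemma stone_cech_hausdorff : hausdorff_space (stone_cech S).
Proof.
move=> u v uv; apply: stone_cechP => A uA; apply: contrapT => /ultraC vA.
have nb w B : ultra_of w B -> nbhs w (basic_open B).
  by move=> wB; apply/nbhs_stone_cech; exists B.
have [w [wA wnA]] := uv _ _ (nb _ _ uA) (nb _ _ vA).
exact: proper_notC wA wnA.
Qed.

Lemma stone_cech_closure_open U : open U -> open (closure U).
Proof.
move=> oU; pose A := [set s | U (principal_ultra s)].
suff -> : closure U = basic_open A by exact: open_basic.
rewrite eqEsubset; split=> u.
  move=> clu; apply: contrapT => /ultraC unA.
  have /clu [v [Uv vnA]] : nbhs u (basic_open (~` A)).
    by apply/nbhs_stone_cech; exists (~` A).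
  have /nbhs_stone_cech [B vB BU] := open_nbhs_nbhs (conj oU Uv).
  have [s [Bs]] := filter_ex (filterI vB vnA); apply.
  by apply: BU; exact/principal_filterP.
move=> uA V /nbhs_stone_cech [B uB BV].
have [s [As Bs]] := filter_ex (filterI uA uB).
by exists (principal_ultra s); split=> //; apply: BV; exact/principal_filterP.
Qed.

HB.instance Definition _ := isExtrDisc.Build (stone_cech S)
  stone_cech_compact stone_cech_hausdorff stone_cech_closure_open.

End stone_cech_extrdisc.

Section stone_cech_functoriality.
Variables (S T : Type) (f : S -> T).

Lemma fmap_ultra (u : stone_cech S) : UltraFilter (fmap f (ultra_of u)).
Proof.
split=> [|G GP uG]; first exact: fmap_proper_filter.
rewrite eqEsubset; split=> // B GB; apply: contrapT => /ultraC unB.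
have /uG GnB : fmap f (ultra_of u) (~` B) by [].
exact: proper_notC GB GnB.
Qed.

(* fmap f u = [set B | u (f @^-1` B)] *)
Definition stone_cech_map (u : stone_cech S) : stone_cech T :=
  StoneCech (fmap_ultra u).

Lemma stone_cech_map_continuous : continuous stone_cech_map.
Proof.
move=> u U /nbhs_stone_cech [B uB BU]; apply/nbhs_stone_cech.
by exists (f @^-1` B) => // v vB; exact: BU.
Qed.

HB.instance Definition _ :=
  isContinuous.Build (stone_cech S) (stone_cech T) stone_cech_map
    stone_cech_map_continuous.

End stone_cech_functoriality.

(* Main.v *)
Require Import Defs.
From mathcomp Require Import all_boot all_classical topology.

(** A pullback [P] maps bijectively, hence homeomorphically, onto the fiber over
    [p], so its topology is induced from beta(N x N).  Let [U] be the trace on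
    the fiber of the union over [k] of the sets [m < k]^*.  The ultrafilter [x]
    = "p-limit over [k] of the points (p, k)" lies in the closure of [U]; were
    this closure open, it would contain the trace of a basic neighbourhood [B^*]
    of [x].  A diagonal argument gives [g] tending to infinity along [p] with
    (n, g n) in [B] for p-almost all [n].  The image of [p] under
    n |-> (n, g n) then lies in [B^*], but the graph of [g] defines a
    neighbourhood of it that misses [U]. *)

Set Implicit Arguments.
Unset Strict Implicit.
Unset Printing Implicit Defensive.

Local Open Scope classical_set_scope.

(** A singleton in [p] would make [p] principal, so the points below [k] can be removed one at a
    time. *)
Lemma nonprincipal_geq (p : stone_cech nat) (k : nat) :
  ~ principal p -> ultra_of p [set n | k <= n].
Proof.
move=> np; elim: k => [|k IHk].
  by apply: filterS filterT => n _ /=.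
have nk : ultra_of p (~` [set k]).
  apply: ultraC => pk; apply: np; exists k.
  rewrite (_ : p = principal_ultra k) //; apply: stone_cechP => A pA.
  by apply/principal_filterP; have [n [-> An]] := filter_ex (filterI pk pA).
apply: filterS2 IHk nk => n /= kn nk.
by rewrite ltn_neqAle kn andbT; apply/eqP => kE; apply: nk.
Qed.

(** Choose [g n] to serve the largest attainable [j <= n]. The cap [n] lets this choice exist even
    when infinitely many [m] satisfy [B (n, m)]; it is harmless because [p] contains
    [[set n | j <= n]]. *)
Lemma diagonal_function (p : stone_cech nat) (B : set (nat * nat)) :
    ~ principal p ->
    (forall j, ultra_of p [set n | exists2 m, j <= m & B (n, m)]) ->
  exists g : nat -> nat,
    forall j, ultra_of p [set n | j <= g n /\ B (n, g n)].
Proof.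
move=> np pB.
have gP n : exists m, forall j, j <= n ->
    (exists2 m', j <= m' & B (n, m')) -> j <= m /\ B (n, m).
  elim: {1}n => [|i [m mP]].
    have [[m _ Bm]|nB] := pselect (exists2 m', 0 <= m' & B (n, m')).
      by exists m => j; rewrite leqn0 => /eqP -> _.
    (* No [m] satisfies [B (n, m)]: the value 0 is arbitrary. *)
    by exists 0 => j; rewrite leqn0 => /eqP ->.
  have [[m' im' Bm']|nB] := pselect (exists2 m', i.+1 <= m' & B (n, m')).
    by exists m' => j ji _; split=> //; exact: leq_trans ji im'.
  exists m => j; rewrite leq_eqVlt => /orP[/eqP -> //|]; exact: mP.
have [g gE] := choice gP; exists g => j.
by apply: filterS2 (nonprincipal_geq j np) (pB j) => n; exact: gE.
Qed.

Section tensor.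
Variables (S T : Type) (p : stone_cech S) (q : stone_cech T).

(** Tensor product of ultrafilters with [q] as outer quantifier: the limit along [q] over [t] of the
    images of [p] under [s |-> (s, t)]. *)
Definition tensor_filter : set_system (S * T) :=
  [set B | ultra_of q [set t | ultra_of p [set s | B (s, t)]]].

Lemma tensor_filter_ultra : UltraFilter tensor_filter.
Proof.
have tP : ProperFilter tensor_filter.
  apply: Build_ProperFilter_ex; first move=> B.
    rewrite /tensor_filter /= => qB.
    by have [t /filter_ex[s Bst]] := filter_ex qB; exists (s, t).
  split=> [|A B|A B AB]; rewrite /tensor_filter /=.
  - by apply: (@filterS _ (ultra_of q)) filterT => t _; exact: filterT.
  - by apply: filterS2 => t; exact: filterI.
  - by apply: filterS => t; apply: filterS => s; exact: AB.
split=> // G GP tG; rewrite eqEsubset; split=> // A GA.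
apply: contrapT => /ultraC tnA.
suff /tG GnA : tensor_filter (~` A) by exact: proper_notC GA GnA.
by apply: filterS tnA => t /ultraC.
Qed.

Definition tensor : stone_cech (S * T) := StoneCech tensor_filter_ultra.

Lemma ultra_of_tensor (B : set (S * T)) :
  ultra_of tensor B = ultra_of q [set t | ultra_of p [set s | B (s, t)]].
Proof. by []. Qed.

Lemma stone_cech_map_fst_tensor : stone_cech_map (@fst S T) tensor = p.
Proof.
apply/esym/stone_cechP => A pA.
by apply: (@filterS _ (ultra_of q) _ setT) filterT.
Qed.

End tensor.

Lemma stone_cech_map_graph (S T : Type) (g : S -> T) (p : stone_cech S) :
  stone_cech_map (@fst S T) (stone_cech_map (fun s => (s, g s)) p) = p.
Proof. exact: stone_cechP. Qed.

Section fiber.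
Variables (X Z P : extrDiscType) (f : continuousType X Z) (z : Z).
Variables (q1 : continuousType P X) (q2 : continuousType P point_space).
Hypothesis pb : is_pullback f (cst z : continuousType point_space Z) q1 q2.

Lemma pullback_fiber_eq (y : P) : f (q1 y) = z.
Proof. by have [fq _] := pb; exact: fq. Qed.

(** Points are maps from [point_space], so the universal property is tested there. *)
Lemma pullback_fiber_surj (x : X) : f x = z -> exists y, q1 y = x.
Proof.
move=> fx; have [_ univ] := pb.
have [//|h [[hx _] _]] := univ point_space
  (cst x : continuousType point_space X)
  (cst tt : continuousType point_space point_space).
by exists (h tt); exact: hx.
Qed.

(** The constant maps at [y] and [y'] solve the same lifting problem, so uniqueness identifies
    them. *)
Lemma pullback_fiber_inj : injective q1.
Proof.
move=> y y' yy'; have [_ univ] := pb.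
have [t|h [_ hu]] := univ point_space
  (cst (q1 y) : continuousType point_space X)
  (cst tt : continuousType point_space point_space).
  exact: pullback_fiber_eq.
have tE (a b : point_space) : a = b by case: a b => -[].
have hy w : q1 w = q1 y -> h = (cst w : continuousType point_space P).
  by move=> wy; apply: hu; split=> t //=; exact: tE.
have hE w : q1 w = q1 y -> h tt = w by move=> /hy ->.
by rewrite -(hE y) // (hE y').
Qed.

(** A continuous injection from a compact space to a Hausdorff one is a closed embedding. *)
Lemma pullback_fiber_nbhs (y : P) (V : set P) :
  nbhs y V -> exists2 W, nbhs (q1 y) W & q1 @^-1` W `<=` V.
Proof.
rewrite nbhsE => -[O [oO Oy] OV].
have cK : compact (q1 @` (~` O)).
  apply: continuous_compact.
    by apply: continuous_subspaceT; exact: cts_fun.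
  apply: (subclosed_compact _ (@extrdisc_compact P)) => //.
  exact: open_closedC.
have clK := compact_closed (@extrdisc_hausdorff X) cK.
exists (~` (q1 @` (~` O))).
  apply: open_nbhs_nbhs; split; first exact: closed_openC.
  by move=> [y' nOy' /pullback_fiber_inj yy']; apply: nOy'; rewrite yy'.
by move=> y' Wy'; apply: OV; apply: contrapT => nOy'; apply: Wy'; exists y'.
Qed.

End fiber.

Theorem theorem4p13 (p : stone_cech nat) (p_nonprincipal : ~ principal p) :
  ~ has_pullback
      (stone_cech_map (@fst nat nat)
        : continuousType (stone_cech (nat * nat)) (stone_cech nat))
      (cst p : continuousType point_space (stone_cech nat)).
Proof.
move=> [P [q1 [q2 pb]]].
have qc : continuous q1 by exact: cts_fun.
pose below k : set (nat * nat) := [set nm | nm.2 < k].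
pose U : set P := \bigcup_k q1 @^-1` (basic_open (below k)).
have oU : open U.
  apply: bigcup_open => k _; apply: open_comp; last exact: open_basic.
  by move=> y _; exact: qc.
have [x qx] := pullback_fiber_surj pb (stone_cech_map_fst_tensor p p).
have clx : closure U x.
  (* Some slice of [B] at height [k] is in [p]; the image of [p] under [n |-> (n, k)] then gives a
     point of [U] in [V]. *)
  move=> V /(pullback_fiber_nbhs pb) [W]; rewrite qx.
  move=> /nbhs_stone_cech [B]; rewrite ultra_of_tensor => /filter_ex [k pBk] BW WV.
  have [y qy] := pullback_fiber_surj pb (stone_cech_map_graph (fun=> k) p).
  exists y; split; last by apply: WV; apply: BW; rewrite qy.
  exists k.+1 => //; rewrite /preimage /= qy.
  by apply: (@filterS _ (ultra_of p) _ setT) filterT => n _; exact: ltnSn.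
have /(pullback_fiber_nbhs pb) [W] : nbhs x (closure U).
  by apply: open_nbhs_nbhs; split=> //; exact: extrdisc_closure_open.
rewrite qx => /nbhs_stone_cech [B]; rewrite ultra_of_tensor => xB BW WU.
have [|g gP] := @diagonal_function p B p_nonprincipal.
  move=> j.
  have [k [jk pBk]] := filter_ex (filterI (nonprincipal_geq j p_nonprincipal) xB).
  by apply: filterS pBk => n Bnk; exists k.
have [y qy] := pullback_fiber_surj pb (stone_cech_map_graph g p).
have /WU cly : (q1 @^-1` W) y.
  by apply: BW; rewrite qy; apply: filterS (gP 0) => n [].
pose graph : set (nat * nat) := [set nm | nm.2 = g nm.1].
have /cly [v [[k _ vk] vg]] : nbhs y (q1 @^-1` basic_open graph).
  apply: qc; apply/nbhs_stone_cech; exists graph => //.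
  by rewrite qy; apply: (@filterS _ (ultra_of p) _ setT) filterT.
have vp := pullback_fiber_eq pb v.
(* Since [q1 v] lies over [p], it inherits [k <= g n], which on the graph contradicts [m < k]. *)
have vgk : ultra_of (q1 v) (@fst nat nat @^-1` [set n | k <= g n /\ B (n, g n)]).
  by have := gP k; rewrite -{1}vp.
have [[n m] [[mk mg] [kg _]]] := filter_ex (filterI (filterI vk vg) vgk).
by move: mk mg kg; rewrite /below /graph /= => mk <-; rewrite leqNgt mk.
Qed.
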